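(* For $n\ge1$ let $\Delta_n$ be the right triangle with legs $\sqrt{F_n}$, $\sqrt{F_{n+1}}$ and hypotenuse $\sqrt{F_{n+2}}$, let $A_n=\frac12\sqrt{F_nF_{n+1}}$ be its area, let $C_n$ be its circumscribed circle and $T_n$ its inscribed circle. Then (1) $$\lim_{n\to\infty}\frac{A_n}{\mathrm{Area}(T_n)}=\frac{2\sqrt{\varphi}}{\pi(1+\sqrt{\varphi}-\varphi)^2};$$ (2) $$\lim_{n\to\infty}\frac{\mathrm{Area}(C_n)}{\mathrm{Area}(T_n)}=\frac{\varphi^2}{(1+\sqrt{\varphi}-\varphi)^2}.$$
   Context: $F_n$ denotes the $n$-th Fibonacci number: $F_1=F_2=1$ and $F_{n+1}=F_n+F_{n-1}$ for $n\ge 2$. $\varphi=(1+\sqrt5)/2$. The circumscribed circle of a triangle passes through its three vertices; the inscribed circle is the largest circle contained in the triangle; $\mathrm{Area}$ of a circle means the area of the disc it bounds. *)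

(* Defs.v *)
From HB Require Import structures.
From mathcomp Require Import all_boot all_order all_algebra.
From mathcomp Require Import all_classical all_reals all_analysis.

Set Implicit Arguments.
Unset Strict Implicit.
Unset Printing Implicit Defensive.

Import Order.TTheory GRing.Theory Num.Theory.
Import numFieldNormedType.Exports.

Local Open Scope classical_set_scope.
Local Open Scope ring_scope.

Fixpoint fib (n : nat) : nat :=
  match n with
  | 0 => 0
  | 1 => 1
  | (m.+1 as k).+1 => fib k + fib m
  end.

Definition golden (R : realType) : R := (1 + Num.sqrt 5) / 2.

(* Points of the plane are elements of [R * R]; the library's norm on this type
   is the sup norm, hence the explicit Euclidean distance. *)
Definition edist (R : realType) (p q : R * R) : R :=
  Num.sqrt ((p.1 - q.1) ^+ 2 + (p.2 - q.2) ^+ 2).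

(* The right angle is at [P]; the legs are [PQ] and [PS]. *)
Definition is_right_triangle (R : realType) (P Q S : R * R) (a b c : R) : Prop :=
  [/\ (Q.1 - P.1) * (S.1 - P.1) + (Q.2 - P.2) * (S.2 - P.2) = 0,
      edist P Q = a, edist P S = b & edist Q S = c].

Definition triangle (R : realType) (P Q S : R * R) : set (R * R) :=
  [set p | exists x y z : R,
    [/\ 0 <= x, 0 <= y, 0 <= z, x + y + z = 1
      & p = x *: P + y *: Q + z *: S]].

Record circle (R : realType) := Circle {
  center : R * R;
  radius : R;
  radius_gt0 : 0 < radius
}.

Definition circle_set (R : realType) (C : circle R) : set (R * R) :=
  [set p | edist (center C) p = radius C].

Definition disc (R : realType) (C : circle R) : set (R * R) :=
  [set p | edist (center C) p <= radius C].

Definition area (R : realType) (C : circle R) : R :=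
  fine ((@lebesgue_measure R \x @lebesgue_measure R)%E (disc C)).

Definition is_circumscribed (R : realType) (C : circle R) (P Q S : R * R) : Prop :=
  [/\ circle_set C P, circle_set C Q & circle_set C S].

Definition is_inscribed (R : realType) (T : circle R) (P Q S : R * R) : Prop :=
  circle_set T `<=` triangle P Q S /\
  forall T' : circle R, circle_set T' `<=` triangle P Q S ->
    radius T' <= radius T.

(* Main.v *)
(** For a right triangle with legs a, b and hypotenuse c the circumradius is
    c / 2 and the inradius is (a + b - c) / 2, so after division by a^2 both
    ratios become rational expressions in b / a and c / a. Here these are square
    roots of ratios of Fibonacci numbers and tend to sqrt phi and
    sqrt (phi^2) = phi. *)

Require Import Defs.
From mathcomp Require Import all_boot all_order all_algebra.
From mathcomp Require Import all_classical all_reals all_analysis.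
From mathcomp Require Import ring lra.
Import Order.TTheory GRing.Theory Num.Theory.
Import numFieldNormedType.Exports.
(* Restores [edist], [center], [radius], shadowed by MathComp-Analysis. *)
Import Defs.
Local Open Scope classical_set_scope.
Local Open Scope ring_scope.

Set Implicit Arguments.
Unset Strict Implicit.

(** * Ratios of Fibonacci numbers and the golden ratio *)

Lemma fibSS (n : nat) : fib n.+2 = (fib n.+1 + fib n)%N.
Proof. by []. Qed.

Lemma fib_gt0 (n : nat) : (0 < fib n.+1)%N.
Proof.
elim/ltn_ind: n => -[|n] IH //.
by rewrite fibSS addn_gt0 IH.
Qed.

Lemma golden_sqr (R : realType) : golden R ^+ 2 = golden R + 1.
Proof.
have s5 : Num.sqrt 5 ^+ 2 = 5 :> R by rewrite sqr_sqrtr// ler0n.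
by rewrite /golden; lra.
Qed.

Lemma golden_gt1 (R : realType) : 1 < golden R.
Proof.
have : 1 < Num.sqrt 5 :> R by rewrite -[X in X < _]sqrtr1 ltr_sqrt ?ltr0n// ltr1n.
by rewrite /golden; lra.
Qed.

Lemma golden_lt2 (R : realType) : golden R < 2.
Proof. by have := golden_sqr R; have := golden_gt1 R; nra. Qed.

(** Both limits have the square of this number in the denominator. It is positive because
    [Num.sqrt (golden R)] exceeds 1 while [golden R] is below 2. *)
Lemma golden_incircle_neq0 (R : realType) : 1 + Num.sqrt (golden R) - golden R != 0.
Proof.
have : 1 < Num.sqrt (golden R).
  by rewrite -[X in X < _]sqrtr1 ltr_sqrt ?(golden_gt1 R)// (lt_trans ltr01 (golden_gt1 R)).
by have := golden_lt2 R; move=> *; apply/lt0r_neq0; lra.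
Qed.

(** Both [golden R] and its conjugate [1 - golden R] are roots of x^2 = x + 1; the error term is a
    power of the conjugate. *)
Lemma fib_golden (R : realType) (n : nat) :
  (fib n.+1)%:R = golden R * (fib n)%:R + (1 - golden R) ^+ n :> R.
Proof.
elim: n => [|n IH]; first by rewrite /= mulr0 add0r expr0.
rewrite fibSS natrD exprS IH.
transitivity ((golden R + 1) * (fib n)%:R + (1 - golden R) ^+ n); first by ring.
by rewrite -(golden_sqr R); ring.
Qed.

Lemma cvg_fib_ratio (R : realType) :
  (fun n => (fib n.+2)%:R / (fib n.+1)%:R : R) @ \oo --> golden R.
Proof.
have f0 n : 0 < (fib n.+1)%:R :> R by rewrite ltr0n fib_gt0.
have -> : (fun n => (fib n.+2)%:R / (fib n.+1)%:R : R) =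
    (fun n => golden R + (1 - golden R) ^+ n.+1 / (fib n.+1)%:R).
  by apply/funext => n; rewrite fib_golden; field; rewrite gt_eqF.
rewrite -[X in _ --> X]addr0; apply: cvgD; first exact: cvg_cst.
have h : `|1 - golden R| < 1.
  by rewrite ltr_norml; have := golden_lt2 R; have := golden_gt1 R; lra.
have g : (fun n => `|1 - golden R| ^+ n.+1) @ \oo --> (0 : R).
  by rewrite (cvg_shiftS (fun n => `|1 - golden R| ^+ n)); apply: cvg_expr; rewrite normr_id.
(* Since [fib n.+1] is at least 1, the error is bounded by a power of the conjugate, whose absolute
   value is below 1. *)
apply: (squeeze_cvgr (f := fun n => - `|1 - golden R| ^+ n.+1)
                     (h := fun n => `|1 - golden R| ^+ n.+1)) => //; last first.
  by rewrite -oppr0; apply: cvgN.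
apply: nearW => n; rewrite -ler_norml normrM normfV normrX.
by rewrite ler_piMr ?exprn_ge0// invf_le1 ?normr_gt0 ?gt_eqF// ger0_norm ?ler1n ?fib_gt0.
Qed.

Lemma cvg_sqrt_fib_ratio (R : realType) :
  (fun n => Num.sqrt (fib n.+2)%:R / Num.sqrt (fib n.+1)%:R : R) @ \oo
    --> Num.sqrt (golden R).
Proof.
rewrite (_ : (fun n => _) =
    @Num.sqrt R \o (fun n => (fib n.+2)%:R / (fib n.+1)%:R)).
  by apply: cvg_comp; [exact: cvg_fib_ratio|exact: sqrt_continuous].
by apply/funext => n /=; rewrite sqrtrM ?ler0n// sqrtrV ?ler0n.
Qed.

Lemma cvg_sqrt_fib_ratio2 (R : realType) :
  (fun n => Num.sqrt (fib n.+3)%:R / Num.sqrt (fib n.+1)%:R : R) @ \oo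
    --> golden R.
Proof.
have f0 n : Num.sqrt (fib n.+1)%:R != 0 :> R by rewrite sqrtr_eq0 -ltNge ltr0n fib_gt0.
have -> : (fun n => Num.sqrt (fib n.+3)%:R / Num.sqrt (fib n.+1)%:R : R) =
    (fun n => Num.sqrt (fib n.+3)%:R / Num.sqrt (fib n.+2)%:R *
              (Num.sqrt (fib n.+2)%:R / Num.sqrt (fib n.+1)%:R)).
  by apply/funext => n; field; rewrite !f0.
have := @cvg_sqrt_fib_ratio R.
rewrite -{2}[golden R]sqr_sqrtr ?(ltW (lt_trans ltr01 (golden_gt1 R)))// => h.
apply: cvgM => //.
(* The first factor is the sequence of the second one, shifted by one index. *)
by move: h; rewrite -[X in X -> _]cvg_shiftS.
Qed.

(** * Circumradius and inradius of a right triangle through dot products *)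

Definition dot (R : realType) (p q : R * R) : R := p.1 * q.1 + p.2 * q.2.

Lemma edist_sqr (R : realType) (p q : R * R) :
  edist p q ^+ 2 = dot (q - p) (q - p).
Proof.
by rewrite sqr_sqrtr ?addr_ge0 ?sqr_ge0// /dot/=; ring.
Qed.

Lemma right_triangleP (R : realType) (P Q S : R * R) (a b c : R) :
  is_right_triangle P Q S a b c ->
  [/\ dot (Q - P) (S - P) = 0, dot (Q - P) (Q - P) = a ^+ 2,
      dot (S - P) (S - P) = b ^+ 2 & c ^+ 2 = a ^+ 2 + b ^+ 2].
Proof.
case=> PQS <- <- <-; rewrite !edist_sqr; split=> //.
by move: PQS; rewrite /dot/=; nra.
Qed.

(** Expansion of the squared norm of w in an orthogonal basis of the plane, with denominators
    cleared so that u and v may vanish. The difference of the two sides is a multiple of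
    [dot u v]. *)
Lemma dot_parseval (R : realType) (w u v : R * R) : dot u v = 0 ->
  dot w w * dot u u * dot v v =
  dot w u ^+ 2 * dot v v + dot w v ^+ 2 * dot u u.
Proof.
case: w u v => [w1 w2] [u1 u2] [v1 v2]; rewrite /dot/= => uv0.
apply/eqP; rewrite -subr_eq0; apply/eqP.
transitivity ((u1 * v1 + u2 * v2) *
  ((u2 * v2 - u1 * v1) * (w1 ^+ 2 - w2 ^+ 2)
   - 2 * w1 * w2 * (u1 * v2 + u2 * v1))); first by ring.
by rewrite uv0 mul0r.
Qed.

(** Equal distances from the centre to P, Q and S fix its dot products with both legs;
    [dot_parseval] then gives its distance to P. *)
Lemma circumscribed_radius (R : realType) (C : circle R) (P Q S : R * R)
    (a b c : R) : 0 < a -> 0 < b ->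
  is_right_triangle P Q S a b c -> is_circumscribed C P Q S ->
  radius C ^+ 2 = c ^+ 2 / 4.
Proof.
move=> a0 b0 /right_triangleP[uv uu vv cE] [hP hQ hS].
have wwE : dot (center C - P) (center C - P) = radius C ^+ 2.
  by rewrite -hP edist_sqr /dot/=; ring.
have wu : dot (center C - P) (Q - P) = a ^+ 2 / 2.
  have : radius C ^+ 2 = dot (Q - center C) (Q - center C).
    by rewrite -hQ edist_sqr.
  by rewrite -wwE -uu /dot/=; lra.
have wv : dot (center C - P) (S - P) = b ^+ 2 / 2.
  have : radius C ^+ 2 = dot (S - center C) (S - center C).
    by rewrite -hS edist_sqr.
  by rewrite -wwE -vv /dot/=; lra.
have ab0 : a ^+ 2 * b ^+ 2 != 0 by rewrite mulf_neq0 ?expf_neq0 ?gt_eqF.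
apply: (mulIf ab0); rewrite mulrA cE.
have := dot_parseval (center C - P) uv.
by rewrite wwE uu vv wu wv => ->; field.
Qed.

(** As the legs are orthogonal, the barycentric weights at Q and S are the two dot products divided
    by [a ^+ 2] and [b ^+ 2]. The conditions say that all three weights are nonnegative, with
    denominators cleared. *)
Lemma right_triangle_halfplanes (R : realType) (P Q S : R * R) (a b c : R)
    (p : R * R) : 0 < a -> 0 < b -> is_right_triangle P Q S a b c ->
  triangle P Q S p <->
  [/\ 0 <= dot (p - P) (Q - P), 0 <= dot (p - P) (S - P) &
      b ^+ 2 * dot (p - P) (Q - P) + a ^+ 2 * dot (p - P) (S - P)
        <= a ^+ 2 * b ^+ 2].
Proof.
move=> a0 b0 /right_triangleP[uv uu vv cE].
have a20 : 0 < a ^+ 2 by rewrite exprn_gt0.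
have b20 : 0 < b ^+ 2 by rewrite exprn_gt0.
split=> [[x [y [z [x0 y0 z0 xyz ->]]]]|[pu pv puv]].
  have xE : x = 1 - y - z by lra.
  have -> : dot (x *: P + y *: Q + z *: S - P) (Q - P) = y * a ^+ 2.
    transitivity (y * dot (Q - P) (Q - P) + z * dot (Q - P) (S - P)); last first.
      by rewrite uv uu mulr0 addr0.
    by rewrite /dot/= /GRing.scale/= xE; ring.
  have -> : dot (x *: P + y *: Q + z *: S - P) (S - P) = z * b ^+ 2.
    transitivity (y * dot (Q - P) (S - P) + z * dot (S - P) (S - P)); last first.
      by rewrite uv vv mulr0 add0r.
    by rewrite /dot/= /GRing.scale/= xE; ring.
  split; [by rewrite mulr_ge0// ltW|by rewrite mulr_ge0// ltW|].
  have -> : b ^+ 2 * (y * a ^+ 2) + a ^+ 2 * (z * b ^+ 2)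
    = (y + z) * (a ^+ 2 * b ^+ 2) by ring.
  rewrite ler_piMl//; first by rewrite mulr_ge0// ltW.
  by lra.
pose y := dot (p - P) (Q - P) / a ^+ 2.
pose z := dot (p - P) (S - P) / b ^+ 2.
have yE : y * a ^+ 2 = dot (p - P) (Q - P) by rewrite divfK ?gt_eqF.
have zE : z * b ^+ 2 = dot (p - P) (S - P) by rewrite divfK ?gt_eqF.
exists (1 - y - z), y, z; split.
- suff : (y + z) * (a ^+ 2 * b ^+ 2) <= 1 * (a ^+ 2 * b ^+ 2).
    by rewrite ler_pM2r ?mulr_gt0//; lra.
  by rewrite mul1r (le_trans _ puv)// -yE -zE; lra.
- by rewrite divr_ge0// ltW.
- by rewrite divr_ge0// ltW.
- by ring.
(* The difference is orthogonal to both legs, so it vanishes. *)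
pose w := p - ((1 - y - z) *: P + y *: Q + z *: S).
have wu : dot w (Q - P) = 0.
  transitivity (dot (p - P) (Q - P) - y * dot (Q - P) (Q - P)
    - z * dot (Q - P) (S - P)); last by rewrite uv uu yE; ring.
  by rewrite /w /dot/= /GRing.scale/=; ring.
have wv : dot w (S - P) = 0.
  transitivity (dot (p - P) (S - P) - y * dot (Q - P) (S - P)
    - z * dot (S - P) (S - P)); last by rewrite uv vv zE; ring.
  by rewrite /w /dot/= /GRing.scale/=; ring.
have := dot_parseval w uv; rewrite uu vv wu wv expr0n/= !mul0r addr0 => /eqP.
rewrite mulf_eq0 (gt_eqF b20) orbF mulf_eq0 (gt_eqF a20) orbF => /eqP ww.
apply/eqP; rewrite -subr_eq0 -/w; move: ww; case: (w) => w1 w2; rewrite /dot/= => ww.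
by rewrite xpair_eqE; apply/andP; split; apply/eqP; nra.
Qed.

(** Cauchy-Schwarz, by the planar Lagrange identity. It bounds how far a point of a circle can lie
    from the centre in the direction of a side's normal. *)
Lemma dot_geN (R : realType) (d g : R * R) (r k : R) : 0 <= r -> 0 <= k ->
  dot d d = r ^+ 2 -> dot g g = k ^+ 2 -> - (r * k) <= dot d g.
Proof.
move=> r0 k0 dd gg.
have : `|dot d g| <= r * k.
  rewrite -(@ler_pXn2r _ 2)// ?nnegrE ?mulr_ge0// exprMn -dd -gg real_normK ?num_real//.
  rewrite -subr_ge0.
  have -> : dot d d * dot g g - dot d g ^+ 2 = (d.1 * g.2 - d.2 * g.1) ^+ 2.
    by rewrite /dot; ring.
  exact: sqr_ge0.
by rewrite ler_norml => /andP[].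
Qed.

Lemma circle_setD (R : realType) (T : circle R) (e : R * R) : dot e e = 1 ->
  circle_set T (center T + radius T *: e).
Proof.
move=> ee; apply/eqP; rewrite -(@eqrXn2 _ 2)// ?sqrtr_ge0 ?ltW ?radius_gt0//.
rewrite edist_sqr; apply/eqP; transitivity (radius T ^+ 2 * dot e e).
  by rewrite /dot/= /GRing.scale/=; ring.
by rewrite ee mulr1.
Qed.

(** The distances from the centre to the three sides are at least the radius. Weighted by the side
    lengths they add up to twice the area, that is [a * b]. *)
Lemma inner_circle_radius_le (R : realType) (T : circle R) (P Q S : R * R)
    (a b c : R) : 0 < a -> 0 < b -> 0 < c ->
  is_right_triangle P Q S a b c -> circle_set T `<=` triangle P Q S ->
  radius T * (a + b + c) <= a * b.
Proof.
move=> a0 b0 c0 rPQS sub.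
have half p := right_triangle_halfplanes p a0 b0 rPQS.
have [uv uu vv cE] := right_triangleP rPQS.
set u := Q - P in uv uu half; set v := S - P in uv vv half.
(* Test the points of the circle in the direction of the three outward unit
   normals of the sides: - u / a, - v / b and n. *)
have touch e : dot e e = 1 -> _ := fun h => (half _).1 (sub _ (circle_setD T h)).
have dotE e f : dot (center T + radius T *: e - P) f =
    dot (center T - P) f + radius T * dot e f.
  by rewrite /dot/= /GRing.scale/=; ring.
have [] := touch (- a^-1 *: u).
  transitivity (a^-1 ^+ 2 * dot u u); first by rewrite /dot/= /GRing.scale/=; ring.
  by rewrite uu -exprMn mulVf ?gt_eqF// expr1n.
rewrite dotE.
have -> : dot (- a^-1 *: u) u = - a.
  transitivity (- a^-1 * dot u u); first by rewrite /dot/= /GRing.scale/=; ring.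
  by rewrite uu; field; rewrite gt_eqF.
move=> hu _ _.
have [] := touch (- b^-1 *: v).
  transitivity (b^-1 ^+ 2 * dot v v); first by rewrite /dot/= /GRing.scale/=; ring.
  by rewrite vv -exprMn mulVf ?gt_eqF// expr1n.
rewrite !dotE.
have -> : dot (- b^-1 *: v) v = - b.
  transitivity (- b^-1 * dot v v); first by rewrite /dot/= /GRing.scale/=; ring.
  by rewrite vv; field; rewrite gt_eqF.
move=> _ hv _.
(* [b ^+ 2 *: u + a ^+ 2 *: v] is orthogonal to [v - u], the direction of the hypotenuse, and has
   length [a * b * c]. *)
pose n := (a * b * c)^-1 *: (b ^+ 2 *: u + a ^+ 2 *: v).
have c2 : c ^+ 2 != 0 by rewrite expf_neq0// gt_eqF.
have [] := touch n.
  transitivity ((a * b * c) ^- 2 * (b ^+ 4 * dot u u + a ^+ 4 * dot v v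
    + 2 * a ^+ 2 * b ^+ 2 * dot u v)).
    by rewrite /dot/= /GRing.scale/= -exprVn; ring.
  rewrite uu vv uv; transitivity ((a * b * c) ^- 2 * (a ^+ 2 * b ^+ 2 * c ^+ 2)).
    by rewrite cE; congr (_ * _); ring.
  by field; rewrite !gt_eqF.
rewrite !dotE.
have -> : dot n u = a * b / c.
  transitivity ((a * b * c)^-1 * (b ^+ 2 * dot u u + a ^+ 2 * dot u v)).
    by rewrite /dot/= /GRing.scale/=; ring.
  by rewrite uu uv; field; rewrite !gt_eqF.
have -> : dot n v = a * b / c.
  transitivity ((a * b * c)^-1 * (b ^+ 2 * dot u v + a ^+ 2 * dot v v)).
    by rewrite /dot/= /GRing.scale/=; ring.
  by rewrite vv uv; field; rewrite !gt_eqF.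
move=> _ _ hn.
have hyp : (a ^+ 2 + b ^+ 2) * (radius T * (a * b / c)) = radius T * (a * b * c).
  by rewrite -cE; field; rewrite gt_eqF.
suff : radius T * (a + b + c) * (a * b) <= a * b * (a * b).
  by rewrite ler_pM2r// mulr_gt0.
have a2 : 0 <= a ^+ 2 by exact: sqr_ge0.
have b2 : 0 <= b ^+ 2 by exact: sqr_ge0.
(* With these weights the dot products of the centre cancel against those in [hn]. *)
have := mulr_ge0 b2 hu; have := mulr_ge0 a2 hv.
move: hn hyp; lra.
Qed.

(** The centre is placed at distance r from both legs; the equation for r makes its distance to the
    hypotenuse r as well. *)
Lemma inner_circle_exists (R : realType) (P Q S : R * R)
    (a b c r : R) : 0 < a -> 0 < b -> 0 < c -> 0 < r ->
  is_right_triangle P Q S a b c -> r * (a + b + c) = a * b ->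
  exists T : circle R, radius T = r /\ circle_set T `<=` triangle P Q S.
Proof.
move=> a0 b0 c0 r0 rPQS rE.
have [uv uu vv cE] := right_triangleP rPQS.
exists (Circle (P + (r / a) *: (Q - P) + (r / b) *: (S - P)) r0); split=> // p.
rewrite /circle_set/= => hp.
apply/(right_triangle_halfplanes p a0 b0 rPQS).
set u := Q - P in uv uu hp *; set v := S - P in uv vv hp *.
set o := P + _ + _ in hp.
have dd : dot (p - o) (p - o) = r ^+ 2 by rewrite -edist_sqr hp.
have pE f : dot (p - P) f = dot (p - o) f + r / a * dot u f + r / b * dot v f.
  by rewrite /o /dot/= /GRing.scale/=; ring.
have pu : dot (p - P) u = dot (p - o) u + r * a.
  rewrite pE uu; have -> : dot v u = 0 by rewrite -uv /dot; ring.
  by field; rewrite !gt_eqF.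
have pv : dot (p - P) v = dot (p - o) v + r * b.
  by rewrite pE vv uv; field; rewrite !gt_eqF.
have du := dot_geN (ltW r0) (ltW a0) dd uu.
have dv := dot_geN (ltW r0) (ltW b0) dd vv.
have abc0 : 0 <= a * b * c by rewrite !mulr_ge0// ltW.
(* The normal of the hypotenuse is negated because [dot_geN] gives a lower bound and an upper one is
   wanted. *)
have nn : dot (- (b ^+ 2 *: u + a ^+ 2 *: v)) (- (b ^+ 2 *: u + a ^+ 2 *: v))
    = (a * b * c) ^+ 2.
  transitivity (b ^+ 4 * dot u u + a ^+ 4 * dot v v
    + 2 * a ^+ 2 * b ^+ 2 * dot u v); first by rewrite /dot/= /GRing.scale/=; ring.
  by rewrite uu vv uv !exprMn cE; ring.
have := dot_geN (ltW r0) abc0 dd nn.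
have -> : dot (p - o) (- (b ^+ 2 *: u + a ^+ 2 *: v)) =
    - (b ^+ 2 * dot (p - o) u + a ^+ 2 * dot (p - o) v).
  by rewrite /dot/= /GRing.scale/=; ring.
rewrite pu pv => dn; split; [lra|lra|].
have : r * (a + b + c) * (a * b) = a ^+ 2 * b ^+ 2 by rewrite rE; ring.
by move: dn; lra.
Qed.

(** By Pythagoras (a + b - c)(a + b + c) = 2ab, so the claimed value attains the upper bound
    [inner_circle_radius_le]; maximality of T forces equality. *)
Lemma inscribed_radius (R : realType) (T : circle R) (P Q S : R * R)
    (a b c : R) : 0 < a -> 0 < b -> 0 < c ->
  is_right_triangle P Q S a b c -> is_inscribed T P Q S ->
  radius T = (a + b - c) / 2.
Proof.
move=> a0 b0 c0 rPQS [sub maxT].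
have [_ _ _ cE] := right_triangleP rPQS.
have s0 : 0 < a + b + c by rewrite !addr_gt0.
have rE : (a + b - c) / 2 * (a + b + c) = a * b by move: cE; lra.
have r0 : 0 < (a + b - c) / 2 by rewrite -(pmulr_lgt0 _ s0) rE mulr_gt0.
have [T' [T'r sub']] := inner_circle_exists a0 b0 c0 r0 rPQS rE.
apply/eqP; rewrite eq_le; apply/andP; split; last by rewrite -T'r; exact: maxT.
by rewrite -(ler_pM2r s0) rE; exact: inner_circle_radius_le rPQS sub.
Qed.

(** * The area of a disc *)

Lemma mem_disc (R : realType) (C : circle R) (p : R * R) :
  disc C p =
  ((p.1 - (center C).1) ^+ 2 + (p.2 - (center C).2) ^+ 2 <= radius C ^+ 2) :> Prop.
Proof.
rewrite /disc/= /edist -(@ler_pXn2r _ 2)// ?nnegrE ?sqrtr_ge0 ?(ltW (radius_gt0 _))//.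
rewrite sqr_sqrtr ?addr_ge0 ?sqr_ge0//.
by rewrite -(opprB p.1) -(opprB p.2) !sqrrN.
Qed.

(** The section is a vertical chord. Where it is empty the formula still holds, since [Num.sqrt] is
    0 on negative numbers. *)
Lemma measure_xsection_disc (R : realType) (C : circle R) (x : R) :
  @lebesgue_measure R (xsection (disc C) x) =
  (2 * Num.sqrt (radius C ^+ 2 - (x - (center C).1) ^+ 2))%:E.
Proof.
set s := Num.sqrt _.
have [xr|xr] := leP ((x - (center C).1) ^+ 2) (radius C ^+ 2); last first.
  rewrite (_ : xsection _ _ = set0).
    by rewrite measure0 /s ler0_sqrtr ?mulr0// subr_le0 ltW.
  rewrite -subset0 => y; rewrite /xsection/= inE mem_disc/= => h.
  move: xr; rewrite ltNge => /negP; apply.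
  by rewrite (le_trans _ h)// lerDl sqr_ge0.
have s2 : s ^+ 2 = radius C ^+ 2 - (x - (center C).1) ^+ 2.
  by rewrite sqr_sqrtr// subr_ge0.
have s0 : 0 <= s by exact: sqrtr_ge0.
rewrite (_ : xsection _ _ = `[(center C).2 - s, (center C).2 + s]%classic).
  rewrite lebesgue_measure_itv/= lte_fin.
  case: ifPn => [_|]; first by rewrite -EFinD; congr EFin; ring.
  (* Here the chord is a single point and [s] is 0. *)
  by rewrite -leNgt => h; congr EFin; lra.
apply/seteqP; split => y; rewrite /xsection/= inE mem_disc/= in_itv/=;
  by rewrite -ler_distl -[`|_| <= s](@ler_pXn2r _ 2)// ?nnegrE// real_normK ?num_real// s2; lra.
Qed.

Lemma integral_sqr_cos (R : realType) (r : R) :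
  (\int[@lebesgue_measure R]_(t in `[(- (pi / 2))%R, (pi / 2)%R])
     (2 * r ^+ 2 * cos t ^+ 2)%:E)%E = (pi * r ^+ 2)%:E.
Proof.
(* An antiderivative, because 1 + cos^2 - sin^2 = 2 cos^2. *)
pose F (t : R) := r ^+ 2 * (t + sin t * cos t).
have dF (t : R) : is_derive t 1 F (2 * r ^+ 2 * cos t ^+ 2).
  rewrite /F; apply: is_derive_eq; rewrite /GRing.scale/=.
  have := cos2Dsin2 t; nra.
have cF : continuous F.
  by move=> t; apply: differentiable_continuous; apply/derivable1_diffP; exact: ex_derive.
rewrite (@continuous_FTC2 _ _ F).
- rewrite /F sinN cosN sin_pihalf cos_pihalf -EFinB; congr EFin; lra.
- by have := pi_gt0 R; lra.
- apply: continuous_subspaceT => t; apply: cvgM; first exact: cvg_cst.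
  by apply: cvgM; exact: continuous_cos.
- split=> [t _| |]; first exact: ex_derive.
    by apply: cvg_at_right_filter; exact: cF.
  by apply: cvg_at_left_filter; exact: cF.
- by move=> t _; rewrite derive1E derive_val.
Qed.

(** The chord lengths are integrated over x with the substitution x = cx + r sin t, for t from -pi/2
    to pi/2. *)
Lemma area_disc (R : realType) (C : circle R) : area C = pi * radius C ^+ 2.
Proof.
rewrite /area /product_measure1 /=.
under eq_integral do rewrite /= measure_xsection_disc.
set cx := (center C).1; set r := radius C.
pose G (x : R) := 2 * Num.sqrt (r ^+ 2 - (x - cx) ^+ 2).
pose F (t : R) := cx + r * sin t.
have dF (t : R) : is_derive t 1 F (r * cos t).
  by rewrite /F; apply: is_derive_eq; rewrite /GRing.scale/=; ring.
have FE : F^`()%classic = fun t => r * cos t.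
  by apply/funext => t; rewrite derive1E derive_val.
have cF : continuous F.
  by move=> t; apply: differentiable_continuous; apply/derivable1_diffP; exact: ex_derive.
have cF' : continuous F^`()%classic.
  by rewrite FE => t; apply: cvgM; [exact: cvg_cst|exact: continuous_cos].
have r0 : 0 < r by exact: radius_gt0.
have pi0 : - (pi / 2) < pi / 2 :> R by have := pi_gt0 R; lra.
have FN : F (- (pi / 2)) = cx - r by rewrite /F sinN sin_pihalf mulrN1.
have FP : F (pi / 2) = cx + r by rewrite /F sin_pihalf mulr1.
(* Outside this interval the radicand is negative, so [G] vanishes. *)
have -> : (\int[@lebesgue_measure R]_x (G x)%:E)%E =
   (\int[@lebesgue_measure R]_(x in `[F (- (pi / 2))%R, F (pi / 2)%R]) (G x)%:E)%E.
  rewrite [RHS]integral_mkcond; apply: eq_integral => x _.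
  rewrite patchE; case: ifPn => //; rewrite notin_setE/= in_itv/= FN FP => h.
  congr EFin; rewrite /G ler0_sqrtr ?mulr0// subr_le0 leNgt; apply/negP => xr.
  apply: h; rewrite -ler_distl -(@ler_pXn2r _ 2)// ?nnegrE ?(ltW r0)//.
  by rewrite real_normK ?num_real// ltW.
rewrite integration_by_substitution_increasing.
- under eq_integral.
    move=> t; rewrite inE/= in_itv/= => tpi.
    (* The cosine is nonnegative on this interval, so the root of (r cos t)^2 is r cos t itself. *)
    have -> : ((G \o F) * F^`()%classic) t = 2 * r ^+ 2 * cos t ^+ 2.
      rewrite FE fctE/= /G /F (addrC cx) addrK exprMn sin2cos2 mulrBr mulr1 subKr -exprMn.
      rewrite sqrtr_sqr ger0_norm; first by ring.
      by rewrite mulr_ge0 ?(ltW r0)// cos_ge0_pihalf.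
    over.
  by rewrite integral_sqr_cos.
- exact: ltW.
- by move=> x y xI yI xy; rewrite ltrD2l ltr_pM2l// ltr_sin.
- by move=> x _; exact: cF'.
- by apply/cvg_ex; eexists; apply: cvg_at_right_filter; exact: cF'.
- by apply/cvg_ex; eexists; apply: cvg_at_left_filter; exact: cF'.
- split=> [t _| |]; first exact: ex_derive.
    by apply: cvg_at_right_filter; exact: cF.
  by apply: cvg_at_left_filter; exact: cF.
- apply: continuous_subspaceT => x; apply: cvgM; first exact: cvg_cst.
  apply: (@continuous_comp _ _ _ (fun x => r ^+ 2 - (x - cx) ^+ 2) (@Num.sqrt R));
    last exact: sqrt_continuous.
  apply: cvgB; first exact: cvg_cst.
  by apply: cvgM; apply: cvgB; [exact: cvg_id|exact: cvg_cst|exact: cvg_id|exact: cvg_cst].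
Qed.

(** * The two limits *)

Theorem theorem5p2 (R : realType) (P Q S : nat -> R * R)
    (A : nat -> R) (C T : nat -> circle R)
    (hPQS : forall n : nat, (1 <= n)%N ->
      is_right_triangle (P n) (Q n) (S n)
        (Num.sqrt (fib n)%:R) (Num.sqrt (fib n.+1)%:R) (Num.sqrt (fib n.+2)%:R))
    (hA : forall n : nat, (1 <= n)%N ->
      A n = 1 / 2 * Num.sqrt ((fib n)%:R * (fib n.+1)%:R))
    (hC : forall n : nat, (1 <= n)%N -> is_circumscribed (C n) (P n) (Q n) (S n))
    (hT : forall n : nat, (1 <= n)%N -> is_inscribed (T n) (P n) (Q n) (S n)) :
  ((fun n : nat => A n / area (T n)) @ \oo -->
     2 * Num.sqrt (golden R)
       / (pi * (1 + Num.sqrt (golden R) - golden R) ^+ 2)) /\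
  ((fun n : nat => area (C n) / area (T n)) @ \oo -->
     golden R ^+ 2 / (1 + Num.sqrt (golden R) - golden R) ^+ 2).
Proof.
(* The index is shifted: triangle [n.+1] has sides [a n], [a n.+1] and [a n.+2], all positive. *)
pose a n : R := Num.sqrt (fib n.+1)%:R.
have a0 n : 0 < a n by rewrite sqrtr_gt0 ltr0n fib_gt0.
have rT n : radius (T n.+1) = (a n + a n.+1 - a n.+2) / 2.
  exact: inscribed_radius (a0 _) (a0 _) (a0 _) (hPQS n.+1 isT) (hT n.+1 isT).
have rC n : radius (C n.+1) ^+ 2 = a n.+2 ^+ 2 / 4.
  exact: circumscribed_radius (a0 _) (a0 _) (hPQS n.+1 isT) (hC n.+1 isT).
(* This is twice the radius of an actual circle, hence positive. *)
have i0 n : a n + a n.+1 - a n.+2 != 0.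
  by apply/lt0r_neq0; have := radius_gt0 (T n.+1); rewrite rT; lra.
have pi0 : pi != 0 :> R by rewrite gt_eqF// pi_gt0.
have L0 := golden_incircle_neq0 R.
have cb : (fun n => a n.+1 / a n) @ \oo --> Num.sqrt (golden R).
  exact: cvg_sqrt_fib_ratio.
have cc : (fun n => a n.+2 / a n) @ \oo --> golden R by exact: cvg_sqrt_fib_ratio2.
have cd : (fun n => (1 + a n.+1 / a n - a n.+2 / a n) ^+ 2) @ \oo -->
    (1 + Num.sqrt (golden R) - golden R) ^+ 2.
  by rewrite expr2; apply: cvgM; apply: cvgB => //; apply: cvgD => //; exact: cvg_cst.
have d0 n : 1 + a n.+1 / a n - a n.+2 / a n != 0.
  have -> : 1 + a n.+1 / a n - a n.+2 / a n = (a n + a n.+1 - a n.+2) / a n.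
    by field; rewrite gt_eqF.
  by rewrite mulf_neq0// invr_eq0 gt_eqF.
split; rewrite -cvg_shiftS /=.
(* The ratio is 2ab / (pi (a + b - c)^2); numerator and denominator are divided by [a n ^+ 2]. *)
- rewrite (_ : (fun n => _) = (fun n => 2 * (a n.+1 / a n) /
      (pi * (1 + a n.+1 / a n - a n.+2 / a n) ^+ 2))).
    apply: cvgM; first by apply: cvgM => //; exact: cvg_cst.
    apply: cvgV; first by rewrite mulf_neq0// expf_neq0.
    by apply: cvgM => //; exact: cvg_cst.
  apply/funext => n; rewrite hA// area_disc rT sqrtrM ?ler0n// -/(a n) -/(a n.+1).
  by have := pi0; move: (pi : R) => p p0; field; rewrite p0 i0 gt_eqF.
(* The factors pi and 1/4 cancel, leaving c^2 / (a + b - c)^2, again divided through by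
   [a n ^+ 2]. *)
- rewrite (_ : (fun n => _) = (fun n => (a n.+2 / a n) ^+ 2 /
      (1 + a n.+1 / a n - a n.+2 / a n) ^+ 2)).
    apply: cvgM; first by rewrite expr2; exact: cvgM.
    by apply: cvgV => //; rewrite expf_neq0.
  apply/funext => n; rewrite !area_disc rC rT.
  by have := pi0; move: (pi : R) => p p0; field; rewrite p0 i0 gt_eqF.
Qed.
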